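(* There is no quaternionic torus whose group of biregular automorphisms is isomorphic to one of the groups $2\mathbb I$, $2\mathbb O$, $2D_{2n}$ ($n\ge4$), $2C_n$ ($n\ge 4$), $1C_n$ ($n$ odd).
   Context: $\mathbb H$ is the skew field of quaternions, $\mathbb S=\{q\in\mathbb H:q^2=-1\}$, $\mathbb S^3=\{q\in\mathbb H:|q|=1\}$. A quaternionic torus is a quotient $T=\mathbb H/L$ with $L$ a rank-4 lattice, i.e. the additive subgroup of $\mathbb H$ generated by four $\mathbb R$-linearly independent elements. The group $Aut(T)$ of biregular automorphisms of $T=\mathbb H/L$ is the group (under composition) of maps $F(q)=qa$ with $a\in\mathbb S^3$ and $F(L)=L$. Let $I,J\in\mathbb S$ be orthogonal and $K=IJ$; put $\omega=\frac{-1+I+J+K}{2}$, $I_{\mathbb O}=\frac{J+K}{\sqrt2}$, $I_{\mathbb I}=\frac{I+\sigma J+\tau K}{2}$ with $\sigma=\frac{\sqrt5-1}{2}$, $\tau=\frac{\sqrt5+1}{2}$, and $e_s=e^{\frac{\pi I}{s}}=\cos\frac{\pi}{s}+I\sin\frac{\pi}{s}$. Denoting by $\langle\langle\cdots\rangle\rangle$ the subgroup of $\mathbb S^3$ generated by given elements: $2\mathbb I=\langle\langle I_{\mathbb I},\omega\rangle\rangle$, $2\mathbb O=\langle\langle I_{\mathbb O},\omega\rangle\rangle$, $2D_{2n}=\langle\langle e_n,J\rangle\rangle$, $2C_n=\langle\langle e_n\rangle\rangle$ and, for $n$ odd, $1C_n=\langle\langle e_{n/2}\rangle\rangle$ (binary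 icosahedral, binary octahedral, binary dihedral of order $4n$, cyclic of order $2n$, cyclic of order $n$). *)

(* Defs.v *)
From HB Require Import structures.
From mathcomp Require Import all_boot all_order all_algebra.
From mathcomp Require Import all_classical all_reals all_analysis.
From mathcomp Require Import ring lra.

Set Implicit Arguments.
Unset Strict Implicit.
Unset Printing Implicit Defensive.
Import Order.TTheory GRing.Theory Num.Theory.

Local Open Scope classical_set_scope.
Local Open Scope ring_scope.

(* Quat a b c d is a + b i + c j + d k, for the standard units i, j, k = ij. *)
Record quat (R : Type) : Type := Quat { q0 : R; q1 : R; q2 : R; q3 : R }.

Section QuaternionAlgebra.
Variable R : realType.
Local Notation H := (quat R).
Implicit Types p q r : H.

Definition quat_tuple q := (q0 q, q1 q, q2 q, q3 q).
Definition tuple_quat (t : R * R * R * R) : H :=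
  Quat t.1.1.1 t.1.1.2 t.1.2 t.2.

Lemma quat_tupleK : cancel quat_tuple tuple_quat.
Proof. by case. Qed.

HB.instance Definition _ := Choice.copy H (can_type quat_tupleK).

Lemma quatP p q :
  q0 p = q0 q -> q1 p = q1 q -> q2 p = q2 q -> q3 p = q3 q -> p = q.
Proof. by case: p q => [a b c d] [a' b' c' d'] /= -> -> -> ->. Qed.

Definition addq p q :=
  Quat (q0 p + q0 q) (q1 p + q1 q) (q2 p + q2 q) (q3 p + q3 q).
Definition oppq p := Quat (- q0 p) (- q1 p) (- q2 p) (- q3 p).
Definition zeroq : H := Quat 0 0 0 0.
Definition oneq : H := Quat 1 0 0 0.
Definition mulq p q := Quat
  (q0 p * q0 q - q1 p * q1 q - q2 p * q2 q - q3 p * q3 q)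
  (q0 p * q1 q + q1 p * q0 q + q2 p * q3 q - q3 p * q2 q)
  (q0 p * q2 q - q1 p * q3 q + q2 p * q0 q + q3 p * q1 q)
  (q0 p * q3 q + q1 p * q2 q - q2 p * q1 q + q3 p * q0 q).
Definition scaleq (a : R) p := Quat (a * q0 p) (a * q1 p) (a * q2 p) (a * q3 p).

Lemma addqA : associative addq.
Proof. by move=> p q r; apply: quatP => /=; ring. Qed.
Lemma addqC : commutative addq.
Proof. by move=> p q; apply: quatP => /=; ring. Qed.
Lemma add0q : left_id zeroq addq.
Proof. by move=> p; apply: quatP => /=; ring. Qed.
Lemma addNq : left_inverse zeroq oppq addq.
Proof. by move=> p; apply: quatP => /=; ring. Qed.

HB.instance Definition _ := GRing.isZmodule.Build H addqA addqC add0q addNq.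

Lemma mulqA : associative mulq.
Proof. by move=> p q r; apply: quatP => /=; ring. Qed.
Lemma mul1q : left_id oneq mulq.
Proof. by move=> p; apply: quatP => /=; ring. Qed.
Lemma mulq1 : right_id oneq mulq.
Proof. by move=> p; apply: quatP => /=; ring. Qed.
Lemma mulqDl : left_distributive mulq addq.
Proof. by move=> p q r; apply: quatP => /=; ring. Qed.
Lemma mulqDr : right_distributive mulq addq.
Proof. by move=> p q r; apply: quatP => /=; ring. Qed.
Lemma oneq_neq0 : oneq != zeroq.
Proof. by apply/eqP => -[] /eqP; rewrite oner_eq0. Qed.

HB.instance Definition _ := GRing.Zmodule_isNzRing.Build H
  mulqA mul1q mulq1 mulqDl mulqDr oneq_neq0.

Lemma scaleqA a b p : scaleq a (scaleq b p) = scaleq (a * b) p.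
Proof. by apply: quatP => /=; ring. Qed.
Lemma scale1q : left_id 1 scaleq.
Proof. by move=> p; apply: quatP => /=; ring. Qed.
Lemma scaleqDr : right_distributive scaleq +%R.
Proof. by move=> a p q; apply: quatP => /=; ring. Qed.
Lemma scaleqDl p : {morph scaleq^~ p : a b / a + b}.
Proof. by move=> a b; apply: quatP => /=; ring. Qed.

HB.instance Definition _ := GRing.Zmodule_isLmodule.Build R H
  scaleqA scale1q scaleqDr scaleqDl.

Lemma scaleqAl (a : R) p q : a *: (p * q) = (a *: p) * q.
Proof. by apply: quatP => /=; ring. Qed.
HB.instance Definition _ := GRing.Lmodule_isLalgebra.Build R H scaleqAl.

Lemma scaleqAr (a : R) p q : a *: (p * q) = p * (a *: q).
Proof. by apply: quatP => /=; ring. Qed.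
HB.instance Definition _ := GRing.Lalgebra_isAlgebra.Build R H scaleqAr.

Definition qdot p q := q0 p * q0 q + q1 p * q1 q + q2 p * q2 q + q3 p * q3 q.
Definition qnorm q : R := Num.sqrt (qdot q q).

Lemma qdot_eq0 q : (qdot q q == 0) = (q == 0).
Proof.
apply/eqP/eqP => [|->]; last by rewrite /qdot /=; ring.
rewrite /qdot => h; apply: quatP => /=; nra.
Qed.

Definition qconj q := Quat (q0 q) (- q1 q) (- q2 q) (- q3 q).
Definition invq q := (qdot q q)^-1 *: qconj q.
Definition unitq : pred H := fun q => q != 0.

Lemma mulVq : {in unitq, left_inverse 1 invq *%R}.
Proof.
move=> q; rewrite /in_mem /= /unitq -qdot_eq0 => q_neq0.
rewrite /invq -scaleqAl; suff -> : qconj q * q = (qdot q q)%:A.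
  by rewrite scalerA mulVf // scale1r.
by apply: quatP => /=; rewrite /qdot; ring.
Qed.

Lemma mulqV : {in unitq, right_inverse 1 invq *%R}.
Proof.
move=> q; rewrite /in_mem /= /unitq -qdot_eq0 => q_neq0.
rewrite /invq -scaleqAr; suff -> : q * qconj q = (qdot q q)%:A.
  by rewrite scalerA mulVf // scale1r.
by apply: quatP => /=; rewrite /qdot; ring.
Qed.

Lemma unitqP p q : q * p = 1 /\ p * q = 1 -> unitq p.
Proof.
case=> qp1 _; apply/eqP => p0; move: qp1; rewrite p0 mulr0 => /eqP.
by rewrite eq_sym oner_eq0.
Qed.

Lemma invq_out : {in [predC unitq], invq =1 id}.
Proof.
move=> q; rewrite inE /= /in_mem /= /unitq negbK => /eqP ->.
by apply: quatP => /=; ring.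
Qed.

HB.instance Definition _ := GRing.NzRing_hasMulInverse.Build H
  mulVq mulqV unitqP invq_out.

Lemma quat_vect_iso : Vector.axiom 4 H.
Proof.
exists (fun q => \row_(i < 4) nth 0 [:: q0 q; q1 q; q2 q; q3 q] i).
  move=> a p q; apply/rowP => -[i lti]; rewrite !mxE /=.
  by case: i lti => [|[|[|[|]]]].
pose f (v : 'rV[R]_4) : H :=
  Quat (v 0 (inord 0)) (v 0 (inord 1)) (v 0 (inord 2)) (v 0 (inord 3)).
exists f.
  by move=> q; apply: quatP; rewrite /= !mxE inordK.
move=> v; apply/rowP => -[i lti]; rewrite !mxE /=.
by case: i lti => [|[|[|[|//]]]] lti /=; congr (v _ _); apply/val_inj;
  rewrite /= inordK.
Qed.

HB.instance Definition _ := Lmodule_hasFinDim.Build R H quat_vect_iso.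

End QuaternionAlgebra.

Section QuaternionicTori.
Variable R : realType.
Local Notation H := (quat R).

Definition imag_units : set H := [set q | q ^+ 2 = -1].

Definition unit_sphere : set H := [set q | qnorm q = 1].

(* divr_closed (mem A) says that 1 \in A and that x / y \in A for x, y \in A. *)
Definition unit_subgroup (G : set H) :=
  G `<=` unit_sphere /\ divr_closed (mem G).

Definition generated_group (A : set H) : set H := smallest unit_subgroup A.

Definition rank4_lattice (L : set H) :=
  exists v : 4.-tuple H,
    free v /\ L = smallest (fun A => zmod_closed (mem A)) [set` v].

(* The torus H / L is given by L, and its biregular automorphisms by the maps
   q |-> q * a of H that preserve L. *)
Definition Aut_torus (L : set H) : set (H -> H) :=
  [set F | exists a, [/\ unit_sphere a, F = (fun q => q * a) & F @` L = L]].

Definition group_iso (X Y : Type) (A : set X) (mulA : X -> X -> X)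
    (B : set Y) (mulB : Y -> Y -> Y) :=
  exists phi : X -> Y, set_bij A B phi /\
    forall x y, A x -> A y -> phi (mulA x y) = mulB (phi x) (phi y).

Definition Aut_torus_isog (L G : set H) :=
  group_iso (Aut_torus L) (fun F1 F2 => F1 \o F2) G (fun x y => x * y).

Definition sigma : R := (Num.sqrt 5 - 1) / 2.
Definition tau : R := (Num.sqrt 5 + 1) / 2.

Definition omega (I J : H) : H := 2^-1 *: (-1 + I + J + I * J).
Definition I_oct (I J : H) : H := (Num.sqrt 2)^-1 *: (J + I * J).
Definition I_icos (I J : H) : H := 2^-1 *: (I + sigma *: J + tau *: (I * J)).
(* exp (pi I / s), for I an imaginary unit. *)
Definition e_ (I : H) (s : R) : H := (cos (pi / s))%:A + sin (pi / s) *: I.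

Definition binary_icosahedral (I J : H) : set H :=
  generated_group [set I_icos I J; omega I J].
Definition binary_octahedral (I J : H) : set H :=
  generated_group [set I_oct I J; omega I J].
Definition binary_dihedral (I J : H) (n : nat) : set H :=
  generated_group [set e_ I n%:R; J].
Definition cyclic_even (I : H) (n : nat) : set H :=
  generated_group [set e_ I n%:R].
Definition cyclic_odd (I : H) (n : nat) : set H :=
  generated_group [set e_ I (n%:R / 2)].

End QuaternionicTori.

(* Main.v *)
Require Import Defs.
From mathcomp Require Import all_boot all_order all_algebra.
From mathcomp Require Import all_classical all_reals all_analysis.
From mathcomp Require Import ring lra.

Import Order.TTheory GRing.Theory Num.Theory.
Local Open Scope classical_set_scope.
Local Open Scope ring_scope.

(** A right multiplication that preserves a lattice is, in a basis of the
    lattice, an integral matrix, and this constrains its trace. If [a] has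
    norm 1 and [L a = L], then [a^2 = t a - 1] with [t = 2 Re a], so that
    [a + a^-1 = t] sends [L] into itself. Expanding [t v] on a basis of [L]
    whose first vector is [v] shows that the real number [t] is an integer
    ([lattice_scale_int]), and it lies between -2 and 2 because [a] has norm 1
    ([stabilizer_crystallographic]).

    For elements of norm 1, these five traces are those of the elements of
    order 1, 2, 3, 4 or 6, that is, those with [a^4 = 1] or [a^6 = 1]. In this
    form the restriction is invariant under isomorphism, and it translates back
    into a restriction on traces in any subgroup of the quaternions isomorphic
    to the automorphism group ([isog_crystallographic]). Four of the five
    families have an element whose trace is not an integer: [2 cos (pi / n)]
    for the even cyclic and the dihedral groups, [- sqrt 2] for the product of
    the two generators of the octahedral group, and [- (1 + sqrt 5) / 2] for
    that of the icosahedral group.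

    The cyclic groups of odd order are excluded by parity: [q |-> - q] is an
    automorphism of every torus, and it is an involution. Since -1 is the only
    quaternion of order 2, a group of quaternions isomorphic to the
    automorphism group contains -1 ([isog_N1]). *)

(** * Quaternions and their real parts *)

Lemma mulq_eq0 (R : realType) (p q : quat R) : p * q = 0 -> p = 0 \/ q = 0.
Proof.
have [->|p0 pq0] := eqVneq p 0; first by left.
by right; apply: (@mulrI _ p) => //; rewrite pq0 mulr0.
Qed.

(** In a skew field, -1 is the only possible element of order 2. *)
Lemma sqrq_eq1 (R : realType) (q : quat R) : q ^+ 2 = 1 -> q = 1 \/ q = -1.
Proof.
move=> q2; have /mulq_eq0 [] : (q - 1) * (q + 1) = 0.
- by rewrite -subr_sqr_1 q2 subrr.
- by move=> /subr0_eq; left.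
- by move=> /eqP s0; right; apply/eqP; rewrite -addr_eq0.
Qed.

Lemma unit_sphereP (R : realType) (q : quat R) :
  unit_sphere q <-> qdot q q = 1.
Proof.
rewrite /unit_sphere /= /qnorm; split=> [h|->]; last exact: sqrtr1.
have q_ge0 : 0 <= qdot q q by rewrite /qdot; nra.
by rewrite -(sqr_sqrtr q_ge0) h expr1n.
Qed.

Lemma qdotM (R : realType) (p q : quat R) :
  qdot (p * q) (p * q) = qdot p p * qdot q q.
Proof. by rewrite /qdot /=; ring. Qed.

Lemma qdotN1 (R : realType) : qdot (-1 : quat R) (-1) = 1.
Proof. by rewrite /qdot /=; ring. Qed.

(** The characteristic equation of a quaternion of norm 1. *)
Lemma sqrq_unit (R : realType) (q : quat R) :
  qdot q q = 1 -> q ^+ 2 = (2 * q0 q) *: q - 1.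
Proof.
rewrite /qdot expr2 => h; apply: quatP => /=; [|ring..].
lra.
Qed.

Lemma imag_unitsP (R : realType) (q : quat R) :
  imag_units q -> q0 q = 0 /\ qdot q q = 1.
Proof.
rewrite /imag_units /= expr2 => h.
have := congr1 (@q0 R) h; have := congr1 (@q1 R) h.
have := congr1 (@q2 R) h; have := congr1 (@q3 R) h => /= h3 h2 h1 h0.
have : q0 q = 0 by nra.
by rewrite /qdot => q00; split=> //; rewrite q00 in h0 *; lra.
Qed.

(** * Crystallographic traces *)

(** The traces [2 Re q] allowed by integrality and by the norm. *)
Definition crystallographic {R : realType} (q : quat R) :=
  2 * q0 q \in [:: -2; -1; 0; 1; 2].

(** The orders for the traces -2, -1, 0, 1, 2 are 2, 3, 4, 6, 1. Equations
    between powers of [q] replace orders here because an isomorphism carries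
    them over without any discussion of minimality. *)
Lemma crystallographic_order (R : realType) (q : quat R) :
  qdot q q = 1 -> crystallographic q -> q ^+ 4 = 1 \/ q ^+ 6 = 1.
Proof.
move=> /[dup] q_unit /sqrq_unit q2.
have E4 : q ^+ 4 = q ^+ 2 * q ^+ 2 by rewrite -exprD.
have E3 : q ^+ 3 = q * q ^+ 2 by rewrite -exprS.
have E6 : q ^+ 6 = q ^+ 3 * q ^+ 3 by rewrite -exprD.
have real_case : forall e : R, e ^+ 2 = 1 -> q0 q = e -> q = e%:A.
  move=> e e2 qe; move: q_unit; rewrite /qdot qe => h.
  by apply: quatP => /=; nra.
rewrite /crystallographic !inE => /orP[/eqP t|/or4P[]/eqP t].
- left; rewrite (real_case (-1)); [|by rewrite sqrrN expr1n|lra].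
  by rewrite scaleN1r -signr_odd expr0.
- right; suff q3 : q ^+ 3 = 1 by rewrite E6 q3 mulr1.
  rewrite E3 q2 t scaleN1r mulrDr mulrN mulrN1 -expr2 q2 t scaleN1r.
  by rewrite opprD !opprK addrAC addrN add0r.
- by left; rewrite E4 q2 t scale0r add0r mulrNN mulr1.
- right; suff q3 : q ^+ 3 = -1 by rewrite E6 q3 mulrNN mulr1.
  by rewrite E3 q2 t scale1r mulrDr mulrN1 -expr2 q2 t scale1r
     addrAC addrN add0r.
- left; rewrite (real_case 1); [|by rewrite expr1n|lra].
  by rewrite scale1r expr1n.
Qed.

Lemma cubeq_eq1 (R : realType) (q : quat R) :
  q ^+ 3 = 1 -> 2 * q0 q = 2 \/ 2 * q0 q = -1.
Proof.
move=> q3; have /mulq_eq0 [] : (q - 1) * (1 + q + q ^+ 2) = 0.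
- have := subrX1 q 3; rewrite q3 subrr !big_ord_recr big_ord0 /= add0r expr0.
  by rewrite expr1 => <-.
- by move=> /subr0_eq ->; left; rewrite /=; ring.
rewrite expr2 => h; right.
have := congr1 (@q0 R) h; have := congr1 (@q1 R) h.
have := congr1 (@q2 R) h; have := congr1 (@Defs.q3 R) h => /= h3 h2 h1 h0.
(* The imaginary part of [1 + q + q^2] is [2 Re q + 1] times that of [q]; a
   real [q] is impossible since [1 + x + x^2] has no real root. *)
suff : 2 * q0 q + 1 = 0 by lra.
have [//|t] := eqVneq (2 * q0 q + 1) 0.
have E1 : q1 q = 0 by apply: (mulfI t); lra.
have E2 : q2 q = 0 by apply: (mulfI t); lra.
have E3 : Defs.q3 q = 0 by apply: (mulfI t); lra.
by rewrite E1 E2 E3 in h0; nra.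
Qed.

(** The polynomials [X^4 - 1] and [X^6 - 1] split over the integers into factors
    of degree at most 2, and a skew field has no zero divisors, so [q] is a root
    of one of these factors, from which its trace is read off. *)
Lemma order_crystallographic (R : realType) (q : quat R) :
  q ^+ 4 = 1 \/ q ^+ 6 = 1 -> crystallographic q.
Proof.
have real_case : q = 1 \/ q = -1 -> crystallographic q.
  rewrite /crystallographic !inE => -[] -> /=; rewrite ?mulrN mulr1 eqxx //.
  by rewrite !orbT.
case=> [|].
  rewrite (exprM q 2 2) => /sqrq_eq1 [/sqrq_eq1 //|/imag_unitsP [q_im _]].
  by rewrite /crystallographic q_im mulr0 !inE eqxx !orbT.
rewrite (exprM q 3 2) /crystallographic !inE => /sqrq_eq1 [/cubeq_eq1 [] ->|q3].
- by rewrite eqxx !orbT.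
- by rewrite eqxx !orbT.
have /cubeq_eq1 /= [t|t] : (- q) ^+ 3 = 1.
- by rewrite exprNn -signr_odd q3 /= expr1 mulrNN mulr1.
- by rewrite (_ : 2 * q0 q = -2) ?eqxx //; lra.
- by rewrite (_ : 2 * q0 q = 1) ?eqxx ?orbT //; lra.
Qed.

(** * Stabilisers of lattices *)

Definition stabilizer {R : realType} (L : set (quat R)) : set (quat R) :=
  [set a | unit_sphere a /\ (fun q => q * a) @` L = L].

Lemma stabilizerM (R : realType) (L : set (quat R)) a b :
  stabilizer L a -> stabilizer L b -> stabilizer L (a * b).
Proof.
case=> /unit_sphereP ua La [/unit_sphereP ub Lb]; split.
  by apply/unit_sphereP; rewrite qdotM ua ub mulr1.
rewrite -{2}Lb -{2}La image_comp; congr image.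
by apply/funext => q /=; rewrite mulrA.
Qed.

Lemma stabilizer1 (R : realType) (L : set (quat R)) : stabilizer L 1.
Proof.
split; first by apply/unit_sphereP; rewrite /qdot /=; ring.
rewrite (_ : (fun q => q * 1) = id) ?image_id //.
by apply/funext => q; rewrite mulr1.
Qed.

Lemma stabilizerX (R : realType) (L : set (quat R)) a n :
  stabilizer L a -> stabilizer L (a ^+ n).
Proof.
move=> La; elim: n => [|n IHn]; first exact: stabilizer1.
by rewrite exprS; exact: stabilizerM.
Qed.

Lemma lattice_zmod_closed (R : realType) (L : set (quat R)) :
  rank4_lattice L -> L 0 /\ (forall x y, L x -> L y -> L (x - y)).
Proof.
case=> v [_ ->]; split=> [A [[A0 _] _]|x y Lx Ly A /[dup] [[[_ AB] _]] CA].
  by move: A0; rewrite in_setE.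
have /mem_set Ax := Lx A CA; have /mem_set Ay := Ly A CA.
by have := AB x y Ax Ay; rewrite inE.
Qed.

(** The coordinates of the elements of [L] on a basis of [L] are integers, and
    [t] is the first coordinate of [t] times the first basis vector. *)
Lemma lattice_scale_int (R : realType) (L : set (quat R)) (t : R) :
  rank4_lattice L -> (forall l, L l -> L (t *: l)) -> t \is a Num.int.
Proof.
case=> v [v_free defL] tL.
have Lint : L `<=` [set x | forall i, coord v i x \is a Num.int].
  rewrite defL; apply: smallest_sub.
    split; first by rewrite inE /= => i; rewrite linear0.
    move=> x y; rewrite !inE /= => xZ yZ i.
    by rewrite linearB /= rpredB.
  move=> _ /= /tnthP [j ->] i.
  by rewrite (tnth_nth 0) coord_free //; case: eqP.
have Lv0 : L v`_0.
  rewrite defL; apply: sub_gen_smallest => /=.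
  by apply: mem_nth; rewrite size_tuple.
have := Lint _ (tL _ Lv0) ord0.
by rewrite linearZ /= -[0%N]/(nat_of_ord (@ord0 3)) coord_free // eqxx mulr1.
Qed.

Lemma stabilizerN1 (R : realType) (L : set (quat R)) :
  rank4_lattice L -> stabilizer L (-1).
Proof.
move=> /lattice_zmod_closed [L0 LB]; split.
  by apply/unit_sphereP; exact: qdotN1.
have LN x : L x -> L (- x) by move=> /(LB _ _ L0); rewrite sub0r.
apply/seteqP; split=> [_ [x Lx <-]|x Lx] /=; first by rewrite mulrN1; exact: LN.
by exists (- x); [exact: LN|rewrite mulrN1 opprK].
Qed.

Lemma stabilizer_crystallographic (R : realType) (L : set (quat R)) a :
  rank4_lattice L -> stabilizer L a -> crystallographic a.
Proof.
move=> latL [/unit_sphereP a_unit La].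
have [L0 LB] := lattice_zmod_closed _ _ latL.
have LD x y : L x -> L y -> L (x + y).
  by move=> Lx Ly; have := LB _ _ Lx (LB _ _ L0 Ly); rewrite sub0r opprK.
have Ma x : L x -> L (x * a) by move=> Lx; rewrite -La; exists x.
have : 2 * q0 a \is a Num.int.
  apply: lattice_scale_int latL _ => l; rewrite -{1}La => -[m Lm <-].
  (* Writing [l = m a] expresses [t l = l a + l a^-1] without the inverse. *)
  have -> : (2 * q0 a) *: (m * a) = m * a * a + m.
    rewrite -mulrA -expr2 (sqrq_unit _ _ a_unit) mulrBr mulr1 subrK.
    by rewrite scalerAr.
  exact: LD (Ma _ (Ma _ Lm)) Lm.
move=> /intrP [k k_eq]; move: a_unit.
rewrite /crystallographic k_eq /qdot => a_unit.
have /andP[] : (-2 <= k <= 2)%R.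
  by rewrite -2!(ler_int R) -k_eq; apply/andP; split; rewrite /=; nra.
rewrite !inE.
case: k {k_eq} => [[|[|[|]]]|[|[|]]] // _ _; by rewrite ?eqxx ?orbT.
Qed.

(** * Groups isomorphic to the automorphism group of a torus *)

(** Composition of right multiplications reverses the product, so the
    isomorphism becomes an anti-isomorphism from the stabiliser; powers are
    insensitive to the reversal. *)
Lemma isog_stabilizer (R : realType) (L G : set (quat R)) :
  rank4_lattice L -> Aut_torus_isog L G ->
  exists psi : quat R -> quat R,
    [/\ set_bij (stabilizer L) G psi, psi 1 = 1 &
        forall a n, stabilizer L a -> psi (a ^+ n) = psi a ^+ n].
Proof.
move=> latL [phi [[phiG phi_inj phi_surj] phiM]].
pose rho a : quat R -> quat R := fun q => q * a.
pose psi a := phi (rho a).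
have rho_aut a : stabilizer L a -> Aut_torus L (rho a) by case=> ua La; exists a.
have rho_inj : injective rho.
  by move=> a b /(congr1 (fun f => f 1)); rewrite /rho !mul1r.
have psiM a b : stabilizer L a -> stabilizer L b -> psi (a * b) = psi b * psi a.
  move=> Sa Sb; rewrite /psi -phiM; [|exact: rho_aut..].
  by congr phi; apply/funext => q; rewrite /rho /= mulrA.
have psi_inj : set_inj (stabilizer L) psi.
  move=> a b; rewrite !in_setE => Sa Sb psi_ab; apply: rho_inj.
  by apply: phi_inj; rewrite ?in_setE //; exact: rho_aut.
have S1 := stabilizer1 _ L; have SN1 := stabilizerN1 _ _ latL.
(* An idempotent quaternion is 0 or 1. The value 0 would force [psi] to
   vanish identically, although it separates 1 from -1. *)
have psi1_neq0 : psi 1 != 0.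
  apply/eqP => psi10.
  have psi0 a : stabilizer L a -> psi a = 0.
    by move=> Sa; rewrite -[a]mulr1 psiM // psi10 mul0r.
  have /(congr1 (@q0 R)) /= : (1 : quat R) = -1.
    by apply: psi_inj; rewrite ?in_setE // !psi0.
  by lra.
have psi1 : psi 1 = 1.
  by apply: (@mulrI _ (psi 1)) => //; rewrite -psiM // !mulr1.
exists psi; split=> //.
- split=> // [a Sa|g /phi_surj [F [a [ua defF La]] <-]].
    by apply: phiG; exact: rho_aut.
  by exists a; [split=> //; rewrite -{2}La defF|rewrite defF].
move=> a n Sa; elim: n => [|n IHn]; first by rewrite !expr0.
by rewrite exprS psiM ?IHn ?exprSr //; exact: stabilizerX.
Qed.

Lemma isog_crystallographic (R : realType) (L G : set (quat R)) :
  rank4_lattice L -> Aut_torus_isog L G ->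
  forall g, G g -> crystallographic g.
Proof.
move=> latL /(isog_stabilizer _ _ _ latL) [psi [[_ _ surj] psi1 psiX]] g.
move=> /surj [a Sa <-]; apply: order_crystallographic.
have [||a4|a6] := crystallographic_order _ a.
- by case: Sa => /unit_sphereP.
- exact: stabilizer_crystallographic latL Sa.
- by left; rewrite -psiX // a4.
- by right; rewrite -psiX // a6.
Qed.

Lemma isog_N1 (R : realType) (L G : set (quat R)) :
  rank4_lattice L -> Aut_torus_isog L G -> G (-1).
Proof.
move=> latL /(isog_stabilizer _ _ _ latL) [psi [[psiG inj _] psi1 psiX]].
have SN1 := stabilizerN1 _ _ latL; have := psiG _ SN1.
have /sqrq_eq1 [psiN1|->//] : psi (-1) ^+ 2 = 1.
  by rewrite -psiX // sqrrN expr1n psi1.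
have /(congr1 (@q0 R)) /= : (-1 : quat R) = 1.
  by apply: inj; rewrite ?in_setE ?psi1 //; exact: stabilizer1.
by lra.
Qed.

(** * The excluded groups *)

Lemma generated_group_mem (R : realType) (A : set (quat R)) a :
  A a -> generated_group A a.
Proof. by move=> Aa; exact: sub_gen_smallest. Qed.

Lemma generated_groupM (R : realType) (A : set (quat R)) a b :
  A a -> A b -> generated_group A (a * b).
Proof.
move=> Aa Ab G [[_ [G1 GV]] AG].
have /mem_set Ga := AG _ Aa; have /mem_set Gb := AG _ Ab.
by have := GV _ _ Ga (GV _ _ G1 Gb); rewrite div1r invrK inE.
Qed.

(** As [2 pi / n] is at most [pi / 2], the duplication formula gives
    [2 cos^2 - 1 >= 0] for the cosine of [pi / n], hence more than [1 / 2]. *)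
Lemma half_lt_cos_pi_div (R : realType) n :
  (4 <= n)%N -> 2^-1 < cos (pi / n%:R : R) < 1.
Proof.
move=> n_ge4; set x : R := pi / n%:R.
have n4 : (4 : R) <= n%:R by rewrite (ler_nat R 4).
have xn : x * n%:R = pi by rewrite divfK // lt0r_neq0 //; lra.
have pi0 := pi_gt0 R; have x0 : 0 < x by rewrite divr_gt0 //; lra.
have x_le : x *+ 2 <= pi / 2 by nra.
have c_gt0 : 0 < cos x by apply: cos_gt0_pihalf; apply/andP; split; lra.
have : 0 <= cos (x *+ 2) by apply: cos_ge0_pihalf; apply/andP; split; lra.
have s_gt0 : 0 < sin x by apply: sin_gt0_pi; apply/andP; split; lra.
have := cos2Dsin2 x; rewrite cos_mulr2n => cs c2.
by apply/andP; split; nra.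
Qed.

Lemma e_not_crystallographic (R : realType) (I : quat R) n :
  imag_units I -> (4 <= n)%N -> ~ crystallographic (e_ I n%:R).
Proof.
move=> /imag_unitsP [I0 _] /(half_lt_cos_pi_div R) /andP[c_gt c_lt].
rewrite /crystallographic /= I0 mulr0 addr0 mulr1 !inE.
by case/orP=> [/eqP|/or4P[]/eqP]; lra.
Qed.

(** De Moivre's formula in the complex line spanned by 1 and I. *)
Lemma de_moivre (R : realType) (I : quat R) (x : R) n :
  imag_units I ->
  ((cos x)%:A + sin x *: I) ^+ n = (cos (x *+ n))%:A + sin (x *+ n) *: I.
Proof.
rewrite /imag_units /= expr2 => I2; elim: n => [|n IHn].
  by rewrite expr0 !mulr0n cos0 sin0 scale1r scale0r addr0.
rewrite exprS IHn mulrS cosD sinD mulrDl !mulrDr.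
rewrite -!scalerAl -!scalerAr !mul1r !mulr1 I2 !scalerA.
rewrite scalerN addrACA [X in _ + X]addrC -scaleNr !scalerDl scaleNr !addrA.
by apply: quatP => /=; ring.
Qed.

(** The powers of the generator [e] form a group because [e^n = 1], and every
    element of it is killed by the odd exponent [n], unlike -1. *)
Lemma N1_notin_cyclic_odd (R : realType) (I : quat R) n :
  imag_units I -> odd n -> ~ cyclic_odd I n (-1).
Proof.
move=> I_im n_odd.
have n_gt0 : (0 < n)%N by case: n n_odd.
set e := e_ I (n%:R / 2).
have [I0 I_unit] := imag_unitsP _ _ I_im.
have e_n : e ^+ n = 1.
  rewrite /e /e_ de_moivre // (_ : _ *+ n = pi *+ 2).
    by rewrite cos2pi sin2pi scale1r scale0r addr0.
  by rewrite -mulr_natr -[RHS]mulr_natr; field; rewrite pnatr_eq0 -lt0n.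
have e_unit : qdot e e = 1.
  have := cos2Dsin2 (pi / (n%:R / 2)); rewrite /e /e_.
  set c := cos _; set s := sin _ => cs.
  have -> : qdot (c%:A + s *: I) (c%:A + s *: I) = c ^+ 2 + s ^+ 2 * qdot I I.
    by rewrite /qdot /= I0; ring.
  by rewrite I_unit mulr1.
have sub : cyclic_odd I n `<=` [set q | exists k, q = e ^+ k].
  apply: smallest_sub; last by move=> _ ->; exists 1%N; rewrite expr1.
  split=> [_ [k ->]|].
    apply/unit_sphereP; elim: k => [|k IHk].
      by rewrite expr0 /qdot /=; ring.
    by rewrite exprS qdotM e_unit IHk mulr1.
  split; first by rewrite inE /=; exists 0%N.
  (* The exponent [l (n - 1)] stands for [- l] modulo [n]. *)
  move=> x y; rewrite !inE /= => -[k ->] [l ->]; exists (k + l * n.-1)%N.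
  have e_l : e ^+ (l * n.-1) * e ^+ l = 1.
    by rewrite -exprD -[X in (_ + X)%N]muln1 -mulnDr addn1 prednK //
      mulnC exprM e_n expr1n.
  rewrite exprD -[e ^+ (l * n.-1)](mulrK (x := e ^+ l)) ?e_l ?mul1r //.
  by apply/unitrP; exists (e ^+ (l * n.-1)); split=> //; rewrite -e_l -!exprD addnC.
move=> /sub /= [k N1].
have : (-1 : quat R) ^+ n = 1 by rewrite N1 -exprM mulnC exprM e_n expr1n.
rewrite -signr_odd n_odd expr1 => /(congr1 (@q0 R)) /=.
by lra.
Qed.

Lemma orthonormal_triple (R : realType) (I J : quat R) :
  imag_units I -> imag_units J -> qdot I J = 0 ->
  [/\ q0 (I * J) = 0, qdot I (I * J) = 0, qdot J (I * J) = 0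
    & qdot (I * J) (I * J) = 1].
Proof.
move=> /imag_unitsP [I0 I1] /imag_unitsP [J0 J1] IJ; rewrite qdotM I1 J1 mulr1.
move: IJ; rewrite /qdot /= I0 J0 => IJ.
by split=> //; [lra|ring|ring].
Qed.

(** For imaginary [x] the real part of [x y] is minus the scalar product of [x]
    with the imaginary part of [y], and [I], [J], [IJ] are orthonormal. *)
Lemma q0_mul_omega (R : realType) (I J : quat R) (a b c : R) :
  imag_units I -> imag_units J -> qdot I J = 0 ->
  q0 ((a *: I + b *: J + c *: (I * J)) * omega I J) = - (a + b + c) / 2.
Proof.
move=> hI hJ IJ.
have [K0 IK JK KK] := orthonormal_triple _ _ _ hI hJ IJ.
have [I0 II] := imag_unitsP _ _ hI; have [J0 JJ] := imag_unitsP _ _ hJ.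
rewrite /omega; move: (I * J) K0 IK JK KK => K K0 IK JK KK.
(* Orthonormality is inserted here so that the remaining identity holds in
   all polynomial variables. *)
have -> : a + b + c = a * (qdot I I + qdot I J + qdot I K)
    + b * (qdot I J + qdot J J + qdot J K)
    + c * (qdot I K + qdot J K + qdot K K).
  by rewrite II IJ IK JJ JK KK; ring.
by rewrite /qdot /= K0 I0 J0; field.
Qed.

Lemma octahedral_not_crystallographic (R : realType) (I J : quat R) :
  imag_units I -> imag_units J -> qdot I J = 0 ->
  ~ crystallographic (I_oct I J * omega I J).
Proof.
move=> hI hJ hIJ; set s : R := (Num.sqrt 2)^-1.
have -> : I_oct I J = 0 *: I + s *: J + s *: (I * J).
  by rewrite scale0r add0r -scalerDr.
rewrite /crystallographic q0_mul_omega //.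
have s2 : s ^+ 2 * 2 = 1.
  by rewrite /s exprVn sqr_sqrtr // mulVf.
rewrite expr2 in s2.
by rewrite !inE => /orP[/eqP|/or4P[]/eqP] t; nra.
Qed.

Lemma icosahedral_not_crystallographic (R : realType) (I J : quat R) :
  imag_units I -> imag_units J -> qdot I J = 0 ->
  ~ crystallographic (I_icos I J * omega I J).
Proof.
move=> hI hJ hIJ.
have -> : I_icos I J =
    2^-1 *: I + (2^-1 * sigma R) *: J + (2^-1 * tau R) *: (I * J).
  by rewrite /I_icos !scalerDr !scalerA.
rewrite /crystallographic q0_mul_omega //.
have s5 : (Num.sqrt 5 : R) ^+ 2 = 5 by rewrite sqr_sqrtr.
rewrite /sigma /tau; set s := Num.sqrt 5 in s5 *; rewrite expr2 in s5.
by rewrite !inE => /orP[/eqP|/or4P[]/eqP] t; nra.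
Qed.

Theorem theorem8p7 (R : realType) (I J : quat R)
    (hI : imag_units I) (hJ : imag_units J) (hIJ : qdot I J = 0) :
  ~ exists L : set (quat R), rank4_lattice L /\
      (Aut_torus_isog L (binary_icosahedral I J) \/
       Aut_torus_isog L (binary_octahedral I J) \/
       (exists n : nat,
          (4 <= n)%N /\ Aut_torus_isog L (binary_dihedral I J n)) \/
       (exists n : nat, (4 <= n)%N /\ Aut_torus_isog L (cyclic_even I n)) \/
       (exists n : nat, odd n /\ Aut_torus_isog L (cyclic_odd I n))).
Proof.
case=> L [latL [iso|[iso|[[n [n4 iso]]|[[n [n4 iso]]|[n [n_odd iso]]]]]]].
- apply: (icosahedral_not_crystallographic _ _ _ hI hJ hIJ).
  apply: isog_crystallographic latL iso _ _.
  by apply: generated_groupM; [left|right].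
- apply: (octahedral_not_crystallographic _ _ _ hI hJ hIJ).
  apply: isog_crystallographic latL iso _ _.
  by apply: generated_groupM; [left|right].
- apply: (e_not_crystallographic _ _ _ hI n4).
  apply: isog_crystallographic latL iso _ _.
  by apply: generated_group_mem; left.
- apply: (e_not_crystallographic _ _ _ hI n4).
  apply: isog_crystallographic latL iso _ _.
  exact: generated_group_mem.
- exact: (N1_notin_cyclic_odd _ _ _ hI n_odd (isog_N1 _ _ _ latL iso)).
Qed.
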